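(* Let $B_{F,G}(t,u)$ be the $n\times n$ Bézout matrix of $F(s,v;t,u)$ and $G(s,v;t,u)$ regarded as polynomials in $(s,v)$, and let $D_i(B_{F,G})$ be the gcd of its $(n-i)$-minors. Then $D_0(B_{F,G})=0$ and, for $i=1,\ldots,n-1$, up to nonzero constants, $$D_i(B_{F,G})=c(t,u)^{n-i}\,d_n(t,u)^{n-i}d_{n-1}(t,u)^{n-i-1}\cdots d_{i+1}(t,u).$$
   Context: Let $a,b,c\in\mathbb C[s,v]$ be homogeneous of the same degree $n\ge3$, $\gcd(a,b,c)=1$, with $\phi=(a:b:c):\mathbb P^1\to\mathbb P^2$ birational onto its image $\mathcal C$. $F(s,v;t,u)=a(s,v)c(t,u)-a(t,u)c(s,v)$, $G(s,v;t,u)=b(s,v)c(t,u)-b(t,u)c(s,v)$. Let $p,q$ be a $\mu$-basis (homogeneous basis of degrees $\mu\le n-\mu$ of the free syzygy module of $(a,b,c)$), $p_\phi=\sum_ip_i(s,v)\phi_i(t,u)$, $q_\phi=\sum_iq_i(s,v)\phi_i(t,u)$ with $(\phi_1,\phi_2,\phi_3)=(a,b,c)$, and $S_{p_\phi,q_\phi}(t,u)$ their $n\times n$ Sylvester matrix in $(s,v)$. The singular factors are homogeneous $d_1,\ldots,d_n\in\mathbb C[t,u]$ with $d_n^{n-i+1}\cdots d_{i+1}^2d_i$ equal (up to constant) to the gcd of the $(n+1-i)$-minors of $S_{p_\phi,q_\phi}(t,u)$ for each $i$. *)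

(* Defs.v *)
From HB Require Import structures.
From mathcomp Require Import all_boot all_order all_algebra.
Set Implicit Arguments. Unset Strict Implicit. Unset Printing Implicit Defensive.
Import Order.TTheory GRing.Theory Num.Theory.
Local Open Scope ring_scope.

(* Bivariate polynomials: P : {poly {poly R}}, P = sum_i (P`_i)(y) x^i,
   i.e. the outer variable is the first variable (s, resp. t) and the inner
   variable is the second one (v, resp. u).  The same type is used for
   C[s,v] and C[t,u]. *)

(* Homogeneous of degree d (the zero polynomial is homogeneous of every degree). *)
Definition homog2 (R : nzRingType) (d : nat) (P : {poly {poly R}}) : Prop :=
  forall i j : nat, (P`_i)`_j != 0 -> (i + j)%N = d.

Definition homog3 (R : nzRingType) (d : nat) (P : {poly {poly {poly R}}}) : Prop :=
  forall i j k : nat, ((P`_i)`_j)`_k != 0 -> (i + j + k)%N = d.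

Definition cst2 (R : nzRingType) (x : R) : {poly {poly R}} := x%:P%:P.

Definition var1 (R : nzRingType) : {poly {poly R}} := 'X.
Definition var2 (R : nzRingType) : {poly {poly R}} := ('X : {poly R})%:P.

Definition coef2 (R : nzRingType) (n : nat) (P : {poly {poly R}}) (k : nat) : R :=
  if (k <= n)%N then (P`_k)`_(n - k) else 0.

Definition eval3 (R : comNzRingType) (P : {poly {poly {poly R}}})
    (x y z : {poly {poly R}}) : {poly {poly R}} :=
  \sum_(i < size P) \sum_(j < size P`_i) \sum_(k < size (P`_i)`_j)
     cst2 (((P`_i)`_j)`_k) * x ^+ i * y ^+ j * z ^+ k.

Definition dvdr (T : comNzRingType) (x y : T) : Prop := exists q : T, y = x * q.

Definition is_gcd_of (T : comNzRingType) (S : T -> Prop) (g : T) : Prop :=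
  (forall x, S x -> dvdr g x) /\
  (forall e, (forall x, S x -> dvdr e x) -> dvdr e g).

(* The k-minors of a square m x m matrix A (determinants of all k x k
   submatrices; non-injective/unordered index maps only add 0 and +- copies,
   which does not affect gcds). *)
Definition minors_set (T : comNzRingType) (m k : nat) (A : 'M[T]_m) (x : T) : Prop :=
  exists (f g : 'I_k -> 'I_m), x = \det (mxsub f g A).

Definition coprime3 (R : idomainType) (a b c : {poly {poly R}}) : Prop :=
  forall g, dvdr g a -> dvdr g b -> dvdr g c -> g \is a GRing.unit.

(* phi = (a:b:c) : P^1 -> P^2 is birational onto its image: it has a rational
   left inverse psi = (psi1 : psi2) : P^2 --> P^1 (forms of the same degree,
   not both vanishing identically on the image), psi o phi = id, i.e.
   (psi1(a,b,c) : psi2(a,b,c)) = (s : v). *)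
Definition birational_onto_image (R : idomainType) (a b c : {poly {poly R}}) : Prop :=
  exists (e : nat) (psi1 psi2 : {poly {poly {poly R}}}),
    [/\ homog3 e psi1, homog3 e psi2,
        (eval3 psi1 a b c != 0 \/ eval3 psi2 a b c != 0) &
        var2 R * eval3 psi1 a b c = var1 R * eval3 psi2 a b c].

Definition syzygy (R : idomainType) (a b c : {poly {poly R}})
    (h : {poly {poly R}} * {poly {poly R}} * {poly {poly R}}) : Prop :=
  h.1.1 * a + h.1.2 * b + h.2 * c = 0.

Definition lincomb2 (R : idomainType) (al be : {poly {poly R}})
    (p q : {poly {poly R}} * {poly {poly R}} * {poly {poly R}}) :=
  (al * p.1.1 + be * q.1.1, al * p.1.2 + be * q.1.2, al * p.2 + be * q.2).

Definition mu_basis (R : idomainType) (n : nat) (a b c : {poly {poly R}}) (mu : nat)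
    (p q : {poly {poly R}} * {poly {poly R}} * {poly {poly R}}) : Prop :=
  (mu <= n - mu)%N /\
  (homog2 mu p.1.1 /\ homog2 mu p.1.2 /\ homog2 mu p.2) /\
  (homog2 (n - mu) q.1.1 /\ homog2 (n - mu) q.1.2 /\ homog2 (n - mu) q.2) /\
  (syzygy a b c p /\ syzygy a b c q) /\
  (forall h, syzygy a b c h -> exists al be, h = lincomb2 al be p q) /\
  (forall al be, lincomb2 al be p q = (0, 0, 0) -> al = 0 /\ be = 0).

(* Bezout matrix (n x n) of two forms of degree n given by their coefficient
   functions f k, g k (coefficient of s^k v^(n-k), zero for k > n):
   (f(x)g(y) - f(y)g(x))/(x - y) = sum_(i,j) B_ij x^i y^j. *)
Definition bezout_mx (T : comNzRingType) (n : nat) (f g : nat -> T) : 'M[T]_n :=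
  \matrix_(i < n, j < n)
     \sum_(q < n | (q <= minn i j)%N)
        (f (i + j + 1 - q)%N * g q - f q * g (i + j + 1 - q)%N).

(* Sylvester matrix ((m1+m2) x (m1+m2)) of forms P of degree m1 and Q of degree m2,
   given by coefficient functions (zero beyond the degree). *)
Definition sylvester_mx (T : comNzRingType) (m1 m2 : nat) (P Q : nat -> T)
    : 'M[T]_(m1 + m2) :=
  \matrix_(i < m1 + m2, j < m1 + m2)
    if (i < m2)%N then (if (i <= j)%N then P (j - i)%N else 0)
    else (if (i - m2 <= j)%N then Q (j - (i - m2))%N else 0).

(* Coefficient (in R[t,u]) of s^k v^(m-k) of
   h_phi = h1(s,v) a(t,u) + h2(s,v) b(t,u) + h3(s,v) c(t,u). *)
Definition phi_coef (R : idomainType) (m : nat) (a b c : {poly {poly R}})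
    (h : {poly {poly R}} * {poly {poly R}} * {poly {poly R}}) (k : nat) :=
  cst2 (coef2 m h.1.1 k) * a + cst2 (coef2 m h.1.2 k) * b + cst2 (coef2 m h.2 k) * c.

(* Coefficient (in R[t,u]) of s^k v^(n-k) of
   F = x(s,v) c(t,u) - x(t,u) c(s,v)  (x = a gives F, x = b gives G). *)
Definition FG_coef (R : idomainType) (n : nat) (x c : {poly {poly R}}) (k : nat) :=
  cst2 (coef2 n x k) * c - cst2 (coef2 n c k) * x.

(* Main.v *)
(* Write phi = (a, b, c)(t, u) and dehomogenize (s : v) to (x : 1).  Since
   F_i G_j - F_j G_i = c det (phi, phi_i, phi_j), where phi_i is the i-th
   coefficient vector of phi(x), column j of the Bezout matrix consists of the
   coefficients of c phi . (phi^[j](x) * phi(x)), where * is the cross product and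
   phi^[j] is the quotient of phi(x) by x^(j+1).  As kappa phi(x) = p(x) * q(x) for
   a nonzero constant kappa, this is c/kappa times
   (p . phi) (phi^[j] . q)(x) - (q . phi) (phi^[j] . p)(x),
   and the factors phi^[j] . q and phi^[j] . p have degrees < deg q and < deg p
   because phi . q = phi . p = 0.  Hence B = c S^T N with N constant.
   If N v = 0, then w = sum_j v_j phi^[j] is orthogonal to p and q, so w is
   parallel to phi(x); since deg w < n this forces w = 0 and then v = 0.  So N is
   invertible and the k-minors of B and of c S have the same common divisors.
   Finally c is a product of linear forms, which are primes of C[t,u], so the
   factor c^k can be taken out of the gcd without knowing that C[t,u] is factorial. *)
Require Import Defs.
From HB Require Import structures.
From mathcomp Require Import all_boot all_order all_algebra.
From mathcomp Require Import perm ring zify.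
Import GRing.Theory Num.Theory.
Local Open Scope ring_scope.

(** * Divisibility and gcds of sets *)

Lemma dvdr0 {T : comNzRingType} (x : T) : dvdr x 0.
Proof. by exists 0; rewrite mulr0. Qed.

Lemma dvdr_mulr {T : comNzRingType} (e x y : T) : dvdr e x -> dvdr e (x * y).
Proof. by case=> z ->; exists (z * y); rewrite mulrA. Qed.

Lemma dvdr_mull {T : comNzRingType} (e x y : T) : dvdr e y -> dvdr e (x * y).
Proof. by rewrite mulrC; apply: dvdr_mulr. Qed.

Lemma dvdr_sum {T : comNzRingType} {I : finType} (e : T) (f : I -> T) :
  (forall i, dvdr e (f i)) -> dvdr e (\sum_i f i).
Proof.
move=> h; apply: (big_ind (dvdr e)) => // [|x y [u ->] [v ->]].
  exact: dvdr0.
by exists (u + v); rewrite mulrDr.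
Qed.

(** A gcd depends on a set only through its common divisors, so families of minors can be compared
    without matching individual minors. *)
Lemma is_gcd_of_congr {T : comNzRingType} (S S' : T -> Prop) (g : T) :
  (forall e, (forall x, S x -> dvdr e x) <-> (forall x, S' x -> dvdr e x)) ->
  is_gcd_of S g -> is_gcd_of S' g.
Proof.
move=> eqS [h1 h2]; split; first exact/(eqS g).1.
by move=> e /(eqS e).2; apply: h2.
Qed.

Definition scaled_set {T : comNzRingType} (r : T) (S : T -> Prop) (x : T) : Prop :=
  exists2 y, S y & x = r * y.

(* In a general domain gcd (r S) need not exist even if gcd S does. *)
Definition gcd_multiplier {T : comNzRingType} (r : T) : Prop :=
  forall S g, is_gcd_of S g -> is_gcd_of (scaled_set r S) (r * g).

Lemma gcd_multiplierM {T : comNzRingType} (r s : T) :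
  gcd_multiplier r -> gcd_multiplier s -> gcd_multiplier (r * s).
Proof.
move=> hr hs S g /hs /hr; rewrite mulrA; apply: is_gcd_of_congr => e; split=> h x.
  by case=> y Sy ->; apply: h; exists (s * y); [exists y | rewrite mulrA].
by case=> _ [y Sy ->] ->; apply: h; exists y; rewrite ?mulrA.
Qed.

Lemma gcd_multiplier0 {T : comNzRingType} : gcd_multiplier (0 : T).
Proof.
move=> S g _; rewrite mul0r; split=> [_ [y _ ->]|e _]; last exact: dvdr0.
by rewrite mul0r; apply: dvdr0.
Qed.

Lemma gcd_multiplier_unit {T : comUnitRingType} (r : T) :
  r \is a GRing.unit -> gcd_multiplier r.
Proof.
move=> Ur S g [h1 h2]; split=> [_ [y /h1 [z ->] ->]|e h].
  by exists z; rewrite mulrA.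
apply/dvdr_mull/h2 => x Sx.
have [|z Ez] := h (r * x); first by exists x.
by exists (r^-1 * z); rewrite mulrCA -Ez mulKr.
Qed.

Lemma gcd_multiplierX {T : comUnitRingType} (r : T) k :
  gcd_multiplier r -> gcd_multiplier (r ^+ k).
Proof.
move=> hr; elim: k => [|k IH]; first by rewrite expr0; apply: gcd_multiplier_unit; apply: unitr1.
by rewrite exprS; apply: gcd_multiplierM.
Qed.

(* The kernel of a morphism to a domain is prime, so r is a prime element. *)
Lemma gcd_multiplier_kernel {T U : idomainType} (f : {rmorphism T -> U}) (r : T) :
  r != 0 -> (forall x, dvdr r x <-> f x = 0) -> gcd_multiplier r.
Proof.
move=> r0 kerf S g [h1 h2]; split=> [_ [y /h1 [z ->] ->]|e h].
  by exists z; rewrite mulrA.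
(* Either [r] divides [e] and is cancelled throughout, or [f e] is nonzero; then in [r * x = e * y]
   the prime [r] divides [y], and [e] already divides [x]. *)
have [/kerf [e' Ee]|fe0] := eqVneq (f e) 0.
  rewrite Ee; suff /h2 [z ->] : forall x, S x -> dvdr e' x by exists z; rewrite mulrA.
  move=> x Sx; have [|z Ez] := h (r * x); first by exists x.
  by exists z; apply: (mulfI r0); rewrite Ez Ee mulrA.
apply/dvdr_mull/h2 => x Sx; have [|y Ey] := h (r * x); first by exists x.
have /eqP : f (r * x) = 0 by apply/kerf; exists x.
rewrite Ey rmorphM mulf_eq0 (negPf fe0) /= => /eqP /kerf [z Ez].
by exists z; apply: (mulfI r0); rewrite Ey Ez mulrCA.
Qed.

(** * Minors *)

(** A weak Cauchy-Binet formula: multilinearity in the rows, with all index maps instead of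
    increasing ones. Each summand is a multiple of a minor of [X], which is all that divisibility
    requires. *)
Lemma det_mulmx_rect {T : comNzRingType} {m k : nat} (A : 'M[T]_(k, m)) (X : 'M[T]_(m, k)) :
  \det (A *m X) =
  \sum_(h : {ffun 'I_k -> 'I_m}) \det (rowsub h X) * \prod_i A i (h i).
Proof.
pose AB (s : 'S_k) i j := A i j * X j (s i).
transitivity (\sum_(h : {ffun 'I_k -> 'I_m}) \sum_(s : 'S_k) (-1) ^+ s * \prod_i AB s i (h i)).
  rewrite exchange_big; apply: eq_bigr => /= s _; rewrite -big_distrr /=.
  congr (_ * _); rewrite -(bigA_distr_bigA (AB s)) /=.
  by apply: eq_bigr => x _; rewrite mxE.
apply: eq_bigr => h _; rewrite mulrC big_distrr /=; apply: eq_bigr => s _.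
rewrite mulrCA big_split //=; congr (_ * (_ * _)).
by apply: eq_bigr => x _; rewrite mxE.
Qed.

Lemma minors_set_tr {T : comNzRingType} {m : nat} k (A : 'M[T]_m) x :
  minors_set k A^T x <-> minors_set k A x.
Proof.
by split=> -[f [g ->]]; exists g, f; rewrite -det_tr; congr (\det _); apply/matrixP => i j; rewrite !mxE.
Qed.

Lemma dvdr_minors_mull {T : comNzRingType} {m : nat} k (e : T) (X A : 'M[T]_m) :
  (forall x, minors_set k A x -> dvdr e x) ->
  forall x, minors_set k (X *m A) x -> dvdr e x.
Proof.
move=> h _ [f [g ->]]; rewrite mxsub_mul det_mulmx_rect.
apply: dvdr_sum => u; apply: dvdr_mulr; apply: h; exists u, g.
by congr (\det _); apply/matrixP => i j; rewrite !mxE.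
Qed.

Lemma dvdr_minors_tr {T : comNzRingType} {m : nat} k (e : T) (A : 'M[T]_m) :
  (forall x, minors_set k A^T x -> dvdr e x) <-> (forall x, minors_set k A x -> dvdr e x).
Proof. by split=> h x /minors_set_tr /h. Qed.

(** Left multiplication keeps every common divisor of the minors, and multiplying by the inverse
    gives the converse. Transposition brings [N] to the left. *)
Lemma is_gcd_of_minors_tr_mul {T : comUnitRingType} {m : nat} k (A N : 'M[T]_m) (g : T) :
  N \in unitmx -> is_gcd_of (minors_set k A) g ->
  is_gcd_of (minors_set k (A^T *m N)) g.
Proof.
move=> UN; apply: is_gcd_of_congr => e.
have -> : A^T *m N = (N^T *m A)^T by rewrite trmx_mul trmxK.
split=> [h|/dvdr_minors_tr h]; first exact/dvdr_minors_tr/dvdr_minors_mull.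
have -> : A = invmx N^T *m (N^T *m A) by rewrite mulKmx // unitmx_tr.
exact: dvdr_minors_mull.
Qed.

Lemma is_gcd_of_minors_scale {T : comNzRingType} {m : nat} k (r : T) (A : 'M[T]_m) (g : T) :
  gcd_multiplier (r ^+ k) -> is_gcd_of (minors_set k A) g ->
  is_gcd_of (minors_set k (r *: A)) (r ^+ k * g).
Proof.
move=> hr /hr; apply: is_gcd_of_congr => e.
have scale (f h : 'I_k -> 'I_m) : \det (mxsub f h (r *: A)) = r ^+ k * \det (mxsub f h A).
  by rewrite -detZ; congr (\det _); apply/matrixP => i j; rewrite !mxE.
split=> h x.
  by case=> f [u ->]; apply: h; rewrite scale; exists (\det (mxsub f u A)) => //; exists f, u.
by case=> y [f [u ->]] ->; apply: h; rewrite -scale; exists f, u.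
Qed.

Lemma is_gcd_of_minors_full0 {T : comNzRingType} {m : nat} (A : 'M[T]_m) :
  \det A = 0 -> is_gcd_of (minors_set m A) 0.
Proof.
move=> dA; have minor0 x : minors_set m A x -> x = 0.
  (* The index maps need not be permutations; as square matrices on either side of [A] they let the
     determinant split off [\det A]. *)
  move=> [f [g ->]]; have -> : mxsub f g A = rowsub f 1%:M *m A *m colsub g 1%:M.
    by rewrite -rowsubE mulmx_colsub mulmx1; apply/matrixP => i j; rewrite !mxE.
  by rewrite !det_mulmx dA mulr0 mul0r.
split=> [x /minor0 ->|e _]; exact: dvdr0.
Qed.

(** * Binary forms *)

Lemma coef2_gt {R : nzRingType} n (P : {poly {poly R}}) k : (n < k)%N -> coef2 n P k = 0.
Proof. by move=> ltnk; rewrite /coef2 (leqNgt k n) ltnk. Qed.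

Lemma homog2_coef {R : nzRingType} n (P : {poly {poly R}}) k :
  homog2 n P -> P`_k = coef2 n P k *: 'X^(n - k).
Proof.
move=> hP; apply/polyP => j; rewrite coefZ coefXn /coef2.
case: (leqP k n) => [lekn|ltnk]; last first.
  by rewrite mul0r; apply/eqP/negPn/negP => /hP; lia.
have [->|jn] := eqVneq j (n - k)%N; first by rewrite mulr1.
by rewrite mulr0; apply/eqP/negPn/negP => /hP; lia.
Qed.

Lemma homog2_size {R : nzRingType} n (P : {poly {poly R}}) :
  homog2 n P -> (size P <= n.+1)%N.
Proof.
by move=> hP; apply/leq_sizeP => k ltnk; rewrite (homog2_coef n) // coef2_gt // scale0r.
Qed.

Lemma homog2B {R : nzRingType} n (P Q : {poly {poly R}}) :
  homog2 n P -> homog2 n Q -> homog2 n (P - Q).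
Proof.
move=> hP hQ i j; rewrite !coefB; have [Pij|/hP //] := eqVneq (P`_i)`_j 0.
by rewrite Pij sub0r oppr_eq0 => /hQ.
Qed.

Lemma homog2M {R : nzRingType} m n (P Q : {poly {poly R}}) :
  homog2 m P -> homog2 n Q -> homog2 (m + n) (P * Q).
Proof.
move=> hP hQ i j PQij; apply/eqP/negPn/negP => ne_ij; case/eqP: PQij.
rewrite coefM coef_sum big1 // => -[k /= ltki] _.
rewrite coefM big1 // => -[l /= ltlj] _.
have [->|/hP Ekl] := eqVneq (P`_k)`_l 0; first by rewrite mul0r.
have [->|/hQ Eij] := eqVneq (Q`_(i - k))`_(j - l) 0; first by rewrite mulr0.
by case/eqP: ne_ij; lia.
Qed.

Definition dehomog {R : comNzRingType} : {poly {poly R}} -> {poly R} :=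
  map_poly (horner_eval 1).

Lemma dehomogD {R : comNzRingType} : {morph @dehomog R : f g / f + g}.
Proof. exact: rmorphD. Qed.

Lemma dehomogB {R : comNzRingType} : {morph @dehomog R : f g / f - g}.
Proof. by move=> f g; rewrite /dehomog rmorphB. Qed.

Lemma dehomogM {R : comNzRingType} : {morph @dehomog R : f g / f * g}.
Proof. exact: rmorphM. Qed.

Lemma dehomog0 {R : comNzRingType} : @dehomog R 0 = 0.
Proof. exact: rmorph0. Qed.

Lemma coef_dehomog {R : comNzRingType} n (P : {poly {poly R}}) k :
  homog2 n P -> (dehomog P)`_k = coef2 n P k.
Proof.
move=> hP; rewrite coef_map /= /horner_eval (homog2_coef n) //.
by rewrite hornerZ hornerXn expr1n mulr1.
Qed.

Lemma size_dehomog {R : comNzRingType} n (P : {poly {poly R}}) :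
  homog2 n P -> (size (dehomog P) <= n.+1)%N.
Proof.
by move=> hP; apply/leq_sizeP => k ltnk; rewrite (coef_dehomog n) // coef2_gt.
Qed.

Lemma dehomog_eq0 {R : comNzRingType} n (P : {poly {poly R}}) :
  homog2 n P -> dehomog P = 0 -> P = 0.
Proof.
move=> hP P0; apply/polyP => k.
by rewrite (homog2_coef n) // -coef_dehomog // P0 !coef0 scale0r.
Qed.

Lemma homog2_sum {R : comNzRingType} n (P : {poly {poly R}}) : homog2 n P ->
  P = \sum_(k < n.+1) cst2 (coef2 n P k) * var1 R ^+ k * var2 R ^+ (n - k).
Proof.
move=> hP; rewrite -[LHS](@take_poly_id _ n.+1) ?homog2_size //.
rewrite /take_poly poly_def; apply: eq_bigr => k _; rewrite (homog2_coef n) //.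
by rewrite /cst2 /var1 /var2 -!mul_polyC polyCM rmorphXn mulrAC.
Qed.

(** The factor theorem over [{poly R}]: s - z v is monic in s with root z v, so its multiples form
    the kernel of an evaluation. *)
Lemma dvdr_linear_form {R : comNzRingType} (z : R) (P : {poly {poly R}}) :
  dvdr ('X - (z *: 'X)%:P) P <-> horner_eval (z *: 'X) P = 0.
Proof.
split=> [[Q ->]|/eqP/factor_theorem [Q ->]]; last by exists Q; rewrite mulrC.
by rewrite rmorphM /= /horner_eval !hornerE subrr mul0r.
Qed.

(** This is the linear form of the remaining point (1 : 0); the quotient is found by shifting every
    inner coefficient down by one degree. *)
Lemma dvdr_var2 {R : comNzRingType} (P : {poly {poly R}}) :
  dvdr (var2 R) P <-> map_poly (horner_eval 0) P = 0.
Proof.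
split=> [[Q ->]|P0].
  by rewrite rmorphM /= map_polyC /= /horner_eval hornerX mul0r.
exists (map_poly (drop_poly 1) P); apply/polyP => k.
rewrite coefCM coef_map_id0 ?drop_poly0r //; apply/polyP => j.
have /(congr1 (fun Q : {poly R} => Q`_k)) := P0.
rewrite coef_map /= coef0 /horner_eval horner_coef0 => Pk0.
by rewrite coefXM; case: j => [|j] /=; rewrite ?coef_drop_poly ?addn1.
Qed.

Lemma homog2_horner {R : comNzRingType} n (P : {poly {poly R}}) (z : R) :
  homog2 n P -> P.[z *: 'X] = (dehomog P).[z] *: 'X^n.
Proof.
move=> hP; rewrite (@horner_coef_wide _ n.+1) ?homog2_size //.
rewrite (@horner_coef_wide _ n.+1 (dehomog P)) ?size_dehomog // scaler_suml.
apply: eq_bigr => k _; rewrite (homog2_coef n) // (coef_dehomog n) //.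
rewrite exprZn -scalerAl -scalerAr scalerA -exprD subnK //.
exact: (leq_ord k).
Qed.

Definition homogenize {R : comNzRingType} n (f : {poly R}) : {poly {poly R}} :=
  \poly_(k < n.+1) (f`_k *: 'X^(n - k)).

Lemma homogenizeK {R : comNzRingType} n (P : {poly {poly R}}) :
  homog2 n P -> homogenize n (dehomog P) = P.
Proof.
move=> hP; apply/polyP => k; rewrite coef_poly (homog2_coef n P) // (coef_dehomog n) //.
by case: ltnP => // ltnk; rewrite coef2_gt // scale0r.
Qed.

Lemma homogenizeS {R : comNzRingType} n (f : {poly R}) :
  (size f <= n.+1)%N -> homogenize n.+1 f = var2 R * homogenize n f.
Proof.
move=> sf; apply/polyP => k; rewrite coefCM !coef_poly ltnS leq_eqVlt.
have [->|_ /=] := eqVneq k n.+1; first by rewrite ltnn nth_default ?scale0r ?mulr0.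
case: ltnP => [lekn|]; last by rewrite mulr0.
by rewrite -scalerAr -exprS subSn.
Qed.

Lemma homogenize_XsubC {R : comNzRingType} n (f : {poly R}) (z : R) :
  (size f <= n.+1)%N ->
  homogenize n.+1 (('X - z%:P) * f) = ('X - (z *: 'X)%:P) * homogenize n f.
Proof.
move=> sf; apply/polyP => k.
rewrite [in RHS]mulrBl coefB coefXM coefCM coef_poly mulrBl coefB coefXM coefCM !coef_poly.
have E j : z *: 'X * (f`_j *: 'X^(n - j)) = (z * f`_j) *: 'X^((n - j).+1).
  by rewrite -scalerAl -scalerAr scalerA -exprS.
case: k => [|k] /=; first by rewrite E !sub0r !subn0 scaleNr.
rewrite !ltnS subSS; case: ltngtP => [ltkn|ltnk|->]; last 2 first.
- by rewrite mulr0 subr0.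
- by rewrite mulr0 (nth_default _ sf) mulr0 !subr0.
by rewrite E subnSK // scalerBl.
Qed.

Lemma var2_neq0 {R : nzRingType} : var2 R != 0.
Proof. by rewrite polyC_eq0 polyX_eq0. Qed.

Lemma gcd_multiplier_var2 {R : idomainType} : gcd_multiplier (var2 R).
Proof. exact: gcd_multiplier_kernel var2_neq0 dvdr_var2. Qed.

(** Induction on the degree of the form: if the top coefficient of [f] vanishes, v splits off,
    otherwise a root z of [f] splits off s - z v. Both are primes given by kernels of evaluations,
    and the remaining constant is zero or a unit. *)
Lemma gcd_multiplier_homog2 {F : closedFieldType} n (P : {poly {poly F}}) :
  homog2 n P -> gcd_multiplier P.
Proof.
move=> hP; rewrite -(homogenizeK n P hP).
move: (dehomog P) (size_dehomog n P hP) => f {P hP}; elim: n f => [|n IH] f sf.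
  rewrite [f]size1_polyC //.
  have -> : homogenize 0 (f`_0)%:P = (f`_0)%:P%:P.
    apply/polyP => -[|k]; rewrite coef_poly ltnS ?leqn0 !coefC //=.
    by rewrite subnn expr0 alg_polyC.
  have [->|f0] := eqVneq f`_0 0; first by rewrite !polyC0; apply: gcd_multiplier0.
  apply: gcd_multiplier_unit.
  by rewrite poly_unitE coefC poly_unitE coefC unitfE f0 !size_polyC polyC_eq0 f0.
move: sf; rewrite leq_eqVlt => /orP [/eqP Ef|ltf]; last first.
  by rewrite homogenizeS //; apply: gcd_multiplierM gcd_multiplier_var2 (IH _ _).
have /closed_rootP [z] : size f != 1 by rewrite Ef.
case/factor_theorem => g Eg; have g0 : g != 0.
  by apply: contra_eq_neq Ef => g0; rewrite Eg g0 mul0r size_poly0.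
have sg : size g = n.+1 by move: Ef; rewrite Eg size_Mmonic ?monicXsubC // size_XsubC addn2; case.
rewrite Eg mulrC homogenize_XsubC ?sg //; apply: gcd_multiplierM (IH _ _); last by rewrite sg.
apply: (gcd_multiplier_kernel (horner_eval (z *: 'X))) (dvdr_linear_form z).
by rewrite polyXsubC_eq0.
Qed.

(** * Coprime forms *)

(** These are the values at (1 : 0); if all three vanished, v would be a common factor. *)
Lemma coprime3_top {R : idomainType} n (a b c : {poly {poly R}}) :
  homog2 n a -> homog2 n b -> homog2 n c -> coprime3 a b c ->
  [|| (dehomog a)`_n != 0, (dehomog b)`_n != 0 | (dehomog c)`_n != 0].
Proof.
move=> ha hb hc co; rewrite -!negb_and; apply/negP => /and3P [/eqP a0 /eqP b0 /eqP c0].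
have dvd x : homog2 n x -> (dehomog x)`_n = 0 -> dvdr (var2 R) x.
  move=> hx x0; apply/dvdr_var2/polyP => k.
  rewrite coef_map (homog2_coef n) // -coef_dehomog //= /horner_eval hornerZ hornerXn coef0.
  have [->|nk] := eqVneq k n; first by rewrite x0 mul0r.
  case: (ltnP k n) => [ltkn|lenk]; first by rewrite expr0n subn_eq0 leqNgt ltkn mulr0.
  by rewrite (coef_dehomog n) // coef2_gt ?mul0r // ltn_neqAle eq_sym nk.
have := co _ (dvd _ ha a0) (dvd _ hb b0) (dvd _ hc c0).
by rewrite poly_unitE coefC /= poly_unitE size_polyX andbF.
Qed.

(** A common root z would make s - z v a common factor of the forms, so the three dehomogenized
    polynomials generate the unit ideal. *)
Lemma coprime3_Bezout {F : closedFieldType} n (a b c : {poly {poly F}}) :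
  homog2 n a -> homog2 n b -> homog2 n c -> coprime3 a b c ->
  exists x y z, x * dehomog a + y * dehomog b + z * dehomog c = 1.
Proof.
move=> ha hb hc co; set g := gcdp (dehomog a) (dehomog b).
have /Bezout_eq1_coprimepP [[u w] /= Euw] : coprimep g (dehomog c).
  apply/negPn/negP => /closed_rootP [z]; rewrite !root_gcd => /andP [/andP [az bz] cz].
  have dvd x : homog2 n x -> root (dehomog x) z -> dvdr ('X - (z *: 'X)%:P) x.
    move=> hx xz; apply/dvdr_linear_form; rewrite /horner_eval (homog2_horner n) //.
    by rewrite (rootP xz) scale0r.
  have := co _ (dvd _ ha az) (dvd _ hb bz) (dvd _ hc cz).
  by rewrite poly_unitE size_XsubC.
have [[x y] /= /eqpP [[k l] /= /andP [k0 l0] Exy]] := Bezoutp (dehomog a) (dehomog b).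
exists (u * (l^-1 * k)%:P * x), (u * (l^-1 * k)%:P * y), w.
rewrite -Euw; congr (_ + _); have -> : g = (l^-1 * k)%:P * (x * dehomog a + y * dehomog b).
  by rewrite mul_polyC -scalerA Exy scalerA mulVf // scale1r.
ring.
Qed.

(** * Triples of polynomials *)

Definition dot3 {T : comNzRingType} (u v : T * T * T) : T :=
  u.1.1 * v.1.1 + u.1.2 * v.1.2 + u.2 * v.2.

Definition cross3 {T : comNzRingType} (u v : T * T * T) : T * T * T :=
  (u.1.2 * v.2 - u.2 * v.1.2, u.2 * v.1.1 - u.1.1 * v.2, u.1.1 * v.1.2 - u.1.2 * v.1.1).

Definition map3 {T U : Type} (f : T -> U) (u : T * T * T) : U * U * U :=
  (f u.1.1, f u.1.2, f u.2).

Definition all3 {T : Type} (P : T -> Prop) (u : T * T * T) : Prop :=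
  [/\ P u.1.1, P u.1.2 & P u.2].

Definition scale3 {T : comNzRingType} (k : T) : T * T * T -> T * T * T := map3 ( *%R^~ k).

(** The triple phi^[j] of the outline: quotients by x^(j+1), remainders discarded. *)
Definition drop3 {R : nzRingType} j : {poly R} * {poly R} * {poly R} -> _ := map3 (drop_poly j.+1).

Lemma cross3_cross3 {T : comNzRingType} (u p q : T * T * T) :
  cross3 u (cross3 p q) =
  (p.1.1 * dot3 u q - q.1.1 * dot3 u p, p.1.2 * dot3 u q - q.1.2 * dot3 u p,
   p.2 * dot3 u q - q.2 * dot3 u p).
Proof. by rewrite /cross3 /dot3 /=; congr (_, _, _); ring. Qed.

Lemma cross3_orthogonal {T : comNzRingType} (u p q : T * T * T) :
  dot3 u p = 0 -> dot3 u q = 0 -> cross3 u (cross3 p q) = 0.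
Proof. by move=> up uq; rewrite cross3_cross3 up uq !mulr0 subr0. Qed.

(** The triple product x × (w × u) = (x·u) w - (x·w) u; the relation x·u = 1 replaces a division. *)
Lemma parallel3 {T : comNzRingType} (x u w : T * T * T) :
  dot3 x u = 1 -> cross3 w u = 0 -> w = scale3 (dot3 x w) u.
Proof.
case: x u w => [[x1 x2] x3] [[u1 u2] u3] [[w1 w2] w3].
rewrite /dot3 /cross3 /scale3 /map3 /= => xu [E1 E2 E3].
congr (_, _, _); rewrite -[LHS]mulr1 -xu; apply/eqP; rewrite -subr_eq0; apply/eqP.
- by transitivity (x2 * (w1 * u2 - w2 * u1) - x3 * (w3 * u1 - w1 * u3)); [ring | rewrite E2 E3; ring].
- by transitivity (x3 * (w2 * u3 - w3 * u2) - x1 * (w1 * u2 - w2 * u1)); [ring | rewrite E1 E3; ring].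
- by transitivity (x1 * (w3 * u1 - w1 * u3) - x2 * (w2 * u3 - w3 * u2)); [ring | rewrite E1 E2; ring].
Qed.

(** Some component of [u] has degree at least [n], which bounds the degree of the multiplier. It is
    applied with [m = 1], giving a constant, and with [m = 0], giving zero. *)
Lemma parallel3_size {F : fieldType} m n (x u w : {poly F} * {poly F} * {poly F}) :
  dot3 x u = 1 -> cross3 w u = 0 ->
  [|| u.1.1`_n != 0, u.1.2`_n != 0 | u.2`_n != 0] ->
  all3 (fun f : {poly F} => (size f <= n + m)%N) w ->
  exists2 k : {poly F}, (size k <= m)%N & w = scale3 k u.
Proof.
move=> xu wu un; rewrite {1}(parallel3 x u w) //; set k := dot3 x w => -[s1 s2 s3].
exists k; last exact: parallel3.
have size_le (f : {poly F}) : f`_n != 0 -> (size (f * k)%R <= n + m)%N -> (size k <= m)%N.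
  move=> fn; have [->|k0] := eqVneq k 0; first by rewrite size_poly0.
  have ltnf : (n < size f)%N by rewrite ltnNge; apply: contra fn => /leq_sizeP ->.
  have f0 : f != 0 by apply: contra_neq fn => ->; rewrite coef0.
  rewrite size_mul // => h; rewrite -(leq_add2l n); apply: leq_trans h; move: ltnf.
  by case: (size f) => // l; rewrite ltnS addSn /= => ltnl; rewrite leq_add2r.
by case/or3P: un => [/size_le|/size_le|/size_le]; apply.
Qed.

(** * Coefficients of the Bézout and Sylvester matrices *)

Lemma bezout_coef {T : comNzRingType} (n i j : nat) (f g : {poly T}) : (i < n)%N ->
  \sum_(q < n | (q <= minn i j)%N)
     (f`_(i + j + 1 - q) * g`_q - g`_(i + j + 1 - q) * f`_q)
  = (drop_poly j.+1 f * g - drop_poly j.+1 g * f)`_i.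
Proof.
move=> ltin; pose t q := f`_(i + j + 1 - q) * g`_q - g`_(i + j + 1 - q) * f`_q.
transitivity (\sum_(0 <= q < (minn i j).+1) t q).
  rewrite -(big_mkord (fun q => (q <= minn i j)%N) t) [RHS](big_nat_widen _ _ n); last first.
    by rewrite (leq_ltn_trans (geq_minl i j)).
  by apply: eq_bigl => q; rewrite ltnS.
transitivity (\sum_(0 <= q < i.+1) t q); last first.
  rewrite coefB !coefMr -sumrB big_mkord; apply: eq_bigr => q _; rewrite !coef_drop_poly.
  by have -> : (i - q + j.+1 = i + j + 1 - q)%N by have := leq_ord q; lia.
have [leij|ltji] := leqP i j; first by [].
(* The extra range j < q <= i contributes nothing: q -> i + j + 1 - q maps it to itself and
   exchanges the two products. *)
rewrite [RHS](big_cat_nat (n := j.+1) (leq0n _)) /=; last by lia.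
rewrite [X in _ + X](_ : _ = 0) ?addr0 ?(minn_idPr (ltnW ltji)) //.
rewrite sumrB [X in _ - X]big_nat_rev /=; apply/eqP; rewrite subr_eq0; apply/eqP.
apply: eq_big_nat => q hq; rewrite [RHS]mulrC.
have -> : (j.+1 + i.+1 - q.+1 = i + j + 1 - q)%N by lia.
by congr (_ * _`_ _); lia.
Qed.

HB.instance Definition _ (R : comNzRingType) :=
  GRing.RMorphism.copy (@cst2 R) (polyC \o polyC).

Lemma cst2B {R : comNzRingType} : {morph @cst2 R : x y / x - y}.
Proof. by move=> x y; rewrite /cst2 !polyCB. Qed.

Lemma cst2N {R : comNzRingType} : {morph @cst2 R : x / - x}.
Proof. by move=> x; rewrite /cst2 !polyCN. Qed.

Lemma cst2M {R : comNzRingType} : {morph @cst2 R : x y / x * y}.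
Proof. by move=> x y; rewrite /cst2 !polyCM. Qed.

Lemma cst2_0 {R : comNzRingType} : cst2 0 = 0 :> {poly {poly R}}.
Proof. by rewrite /cst2 !polyC0. Qed.

(* The coefficient of x^k in u1(x) a + u2(x) b + u3(x) c. *)
Definition pair_coef {R : comNzRingType} (phi : {poly {poly R}} * {poly {poly R}} * {poly {poly R}})
    (u : {poly R} * {poly R} * {poly R}) (k : nat) : {poly {poly R}} :=
  dot3 (map3 (fun f : {poly R} => cst2 f`_k) u) phi.

Lemma phi_coefE {R : idomainType} m (a b c : {poly {poly R}}) h k :
  all3 (homog2 m) h -> phi_coef m a b c h k = pair_coef (a, b, c) (map3 dehomog h) k.
Proof. by case=> h1 h2 h3; rewrite /pair_coef /dot3 /= !(coef_dehomog m). Qed.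

(** Termwise this is F_k G_q - F_q G_k = c phi·(phi_k × phi_q) with k = i + j + 1 - q, summed by
    [bezout_coef]. *)
Lemma bezout_FGE {R : idomainType} n (a b c : {poly {poly R}}) (i j : 'I_n) :
  homog2 n a -> homog2 n b -> homog2 n c ->
  let phi := map3 dehomog (a, b, c) in
  bezout_mx n (FG_coef n a c) (FG_coef n b c) i j =
  c * pair_coef (a, b, c) (cross3 (drop3 j phi) phi) i.
Proof.
move=> ha hb hc /=; rewrite mxE /pair_coef /dot3 /= -!(bezout_coef n) // !rmorph_sum.
rewrite !big_distrl -!big_split big_distrr; apply: eq_bigr => q _ /=.
rewrite /FG_coef -!(coef_dehomog n) //.
rewrite !cst2B !cst2M.
move: (cst2 _) (cst2 _) (cst2 _) (cst2 _) (cst2 _) (cst2 _) => x1 x2 x3 x4 x5 x6; ring.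
Qed.

Lemma convolution_truncate {R : comNzRingType} (h : nat -> {poly {poly R}}) (f : {poly R}) m i :
  (size f <= m)%N ->
  \sum_(0 <= k < m) (if (k <= i)%N then h (i - k)%N else 0) * cst2 f`_k =
  \sum_(k < i.+1) h (i - k)%N * cst2 f`_k.
Proof.
move=> sf; rewrite -(big_mkord predT (fun k => h (i - k)%N * cst2 f`_k)).
(* Both sums are widened to one common range; where their conditions differ, either the test fails
   or the coefficient of [f] is zero by default. *)
rewrite [LHS](big_nat_widen _ _ (m + i.+1)) ?leq_addr //.
rewrite [RHS](big_nat_widen _ _ (m + i.+1)) ?leq_addl //.
rewrite [LHS]big_mkcond [RHS]big_mkcond; apply: eq_bigr => k _ /=.
rewrite ltnS; case: ltnP => [_|/(leq_trans sf) fk]; case: leqP => _ //; first by rewrite mul0r.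
by rewrite nth_default // cst2_0 mulr0.
Qed.

Lemma pair_coef_scale {R : comNzRingType} phi (u : {poly R} * {poly R} * {poly R}) (f : {poly R}) i :
  pair_coef phi (scale3 f u) i = \sum_(k < i.+1) pair_coef phi u (i - k) * cst2 f`_k.
Proof.
rewrite /pair_coef /dot3 /= !coefMr !rmorph_sum !big_distrl -!big_split.
apply: eq_bigr => k _ /=; rewrite !cst2M /=.
move: (cst2 _) (cst2 _) (cst2 _) (cst2 _) => x1 x2 x3 x4; ring.
Qed.

(** The shape of N in the outline: column j stacks coefficients of [f j] over those of [- g j], in
    the order of the [m2] shifts of P and the [m1] shifts of Q in [sylvester_mx]. *)
Definition comp_mx {R : nzRingType} m1 m2 (f g : nat -> {poly R}) : 'M[R]_(m1 + m2) :=
  \matrix_(k, j) if (k < m2)%N then (f j)`_k else - (g j)`_(k - m2).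

(** The transposed Sylvester matrix represents (f, h) -> f P + h Q on coefficient vectors; the size
    bounds ensure that no coefficient is cut off. *)
Lemma sylvester_comp_mxE {R : comNzRingType} m1 m2 phi
    (u w : {poly R} * {poly R} * {poly R}) (f g : nat -> {poly R}) (i j : 'I_(m1 + m2)) :
  (size (f j) <= m2)%N -> (size (g j) <= m1)%N ->
  ((sylvester_mx m1 m2 (pair_coef phi u) (pair_coef phi w))^T *m
     map_mx (@cst2 R) (comp_mx m1 m2 f g)) i j =
  pair_coef phi (scale3 (f j) u) i - pair_coef phi (scale3 (g j) w) i.
Proof.
move=> sf sg; rewrite !pair_coef_scale -!(convolution_truncate _ _ _ _ sf).
rewrite -!(convolution_truncate _ _ _ _ sg).
pose F k := (if (k < m2)%N then if (k <= i)%N then pair_coef phi u (i - k) else 0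
   else if (k - m2 <= i)%N then pair_coef phi w (i - (k - m2)) else 0) *
   cst2 (if (k < m2)%N then (f j)`_k else - (g j)`_(k - m2)).
rewrite mxE (eq_bigr (fun k : 'I_(m1 + m2) => F k)) => [|k _]; last by rewrite !mxE.
rewrite -(big_mkord predT F) (big_cat_nat (n := m2)) ?leq_addl //; congr (_ + _).
  by apply: eq_big_nat => k /andP [_ ltk]; rewrite /F ltk.
rewrite -{1}[m2]add0n big_addn addnK -sumrN; apply: eq_bigr => k _.
by rewrite /F ltnNge leq_addl addnK cst2N mulrN.
Qed.

(** * The constant matrix of the factorization is invertible *)

(** Splitting u = take + x^(j+1) drop in u·w = 0 gives x^(j+1) (drop·w) = - take·w, whose degree is
    at most j + m. *)
Lemma size_dot3_drop {F : fieldType} m j (u w : {poly F} * {poly F} * {poly F}) :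
  dot3 u w = 0 -> all3 (fun f : {poly F} => (size f <= m.+1)%N) w ->
  (size (dot3 (drop3 j u) w) <= m)%N.
Proof.
case: u w => [[u1 u2] u3] [[w1 w2] w3]; rewrite /dot3 /all3 /= => uw [s1 s2 s3].
pose D : {poly F} := drop_poly j.+1 u1 * w1 + drop_poly j.+1 u2 * w2 + drop_poly j.+1 u3 * w3.
rewrite -/D.
have ED : D * 'X^(j.+1) = - (take_poly j.+1 u1 * w1 + take_poly j.+1 u2 * w2 + take_poly j.+1 u3 * w3).
  apply/eqP; rewrite -addr_eq0 -uw -{2}(poly_take_drop j.+1 u1).
  rewrite -{2}(poly_take_drop j.+1 u2) -{2}(poly_take_drop j.+1 u3).
  by apply/eqP; rewrite /D; ring.
have size_take (f g : {poly F}) : (size g <= m.+1)%N -> (size (take_poly j.+1 f * g)%R <= m + j.+1)%N.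
  move=> sg; apply: leq_trans (size_polyMleq _ _) _.
  rewrite -subn1 leq_subLR; apply: leq_trans (leq_add (size_take_poly _ _) sg) _.
  by rewrite addnC addSn addnA.
have : (size (D * 'X^(j.+1))%R <= m + j.+1)%N.
  rewrite ED size_polyN; do 2?[apply: leq_trans (size_polyD _ _) _; rewrite geq_max; apply/andP; split];
    exact: size_take.
have [->|D0] := eqVneq D 0; first by rewrite size_poly0.
by rewrite size_mulXn // addnC leq_add2r.
Qed.

Lemma comp_mx_unit {F : fieldType} m1 m2 (k : F)
    (x u p q : {poly F} * {poly F} * {poly F}) :
  k != 0 -> dot3 x u = 1 -> cross3 p q = scale3 k%:P u ->
  dot3 u p = 0 -> dot3 u q = 0 ->
  all3 (fun f : {poly F} => (size f <= (m1 + m2).+1)%N) u ->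
  [|| u.1.1`_(m1 + m2) != 0, u.1.2`_(m1 + m2) != 0 | u.2`_(m1 + m2) != 0] ->
  all3 (fun f : {poly F} => (size f <= m1.+1)%N) p ->
  all3 (fun f : {poly F} => (size f <= m2.+1)%N) q ->
  comp_mx m1 m2 (fun j => dot3 (drop3 j u) q) (fun j => dot3 (drop3 j u) p) \in unitmx.
Proof.
set N := comp_mx _ _ _ _; set n := (m1 + m2)%N.
move=> k0 xu pq up uq su un sp sq; rewrite unitmxE unitfE -det_tr.
apply/negP => /det0P [v v0 vN].
have rowN (i : 'I_n) : \sum_(j < n) v 0 j * N i j = 0.
  have := congr1 (fun M : 'rV_n => M 0 i) vN; rewrite !mxE => vNi; rewrite -[RHS]vNi.
  by apply: eq_bigr => j _; rewrite [in RHS]mxE.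
pose comb (f : {poly F}) : {poly F} := \sum_(j < n) v 0 j *: drop_poly j.+1 f.
pose w := map3 comb u.
have dot_comb r : dot3 w r = \sum_(j < n) v 0 j *: dot3 (drop3 j u) r.
  rewrite /w /dot3 /= /comb !big_distrl -!big_split; apply: eq_bigr => j _ /=.
  by rewrite -!scalerAl -!scalerDr.
(* The first [m2] rows of N v = 0 are the coefficients of w·q below [m2]; the others vanish by the
   degree bound. The last [m1] rows give w·p likewise. *)
have wq : dot3 w q = 0.
  apply/polyP => i; rewrite dot_comb coef_sum coef0; case: (ltnP i m2) => [lti|lei].
    have ltin : (i < n)%N by rewrite ltn_addl.
    rewrite -[RHS](rowN (Ordinal ltin)); apply: eq_bigr => j _.
    by rewrite coefZ mxE /= lti.
  rewrite big1 // => j _; rewrite coefZ nth_default ?mulr0 //.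
  exact: leq_trans (size_dot3_drop _ _ _ _ uq sq) lei.
have wp : dot3 w p = 0.
  apply/polyP => i; rewrite dot_comb coef_sum coef0; case: (ltnP i m1) => [lti|lei].
    have ltin : (i + m2 < n)%N by rewrite ltn_add2r.
    apply: oppr_inj; rewrite oppr0 -[RHS](rowN (Ordinal ltin)) -sumrN.
    by apply: eq_bigr => j _; rewrite coefZ mxE /= ltnNge leq_addl addnK mulrN.
  rewrite big1 // => j _; rewrite coefZ nth_default ?mulr0 //.
  exact: leq_trans (size_dot3_drop _ _ _ _ up sp) lei.
have wu : cross3 w u = 0.
  have kP0 : k%:P != 0 by rewrite polyC_eq0.
  have := cross3_orthogonal w p q wp wq; rewrite pq /cross3 /= => -[].
  by rewrite !mulrA -!mulrBl => /eqP E1 /eqP E2 /eqP E3; move: E1 E2 E3;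
     rewrite !mulf_eq0 !(negPf kP0) !orbF => /eqP -> /eqP -> /eqP ->.
have sw (f : {poly F}) : (size f <= n.+1)%N -> (size (comb f) <= n + 0)%N.
  move=> sf; rewrite addn0 /comb; apply: (big_ind (fun g : {poly F} => (size g <= n)%N)).
  - by rewrite size_poly0.
  - by move=> g h sg sh; apply: leq_trans (size_polyD _ _) _; rewrite geq_max sg.
  move=> j _; apply: leq_trans (size_scale_leq _ _) _; rewrite size_drop_poly; lia.
(* Dropping coefficients leaves [w] of degree below [n], while [u] has a nonzero coefficient of
   index [n], so the multiplier is zero. *)
have [c] : exists2 c : {poly F}, (size c <= 0)%N & w = scale3 c u.
  by apply: parallel3_size xu wu un _; case: su => s1 s2 s3; split; apply: sw.
rewrite size_poly_leq0 => /eqP -> [].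
rewrite !mulr0 => w1 w2 w3.
(* A triangular system: the coefficient of index n - j - 1 in [comb f] sums v_i f_(n-j+i). Terms
   with i > j exceed the degree of [f] and those with i < j vanish by induction, leaving v_j f_n. *)
have comb0 (f : {poly F}) : comb f = 0 -> (size f <= n.+1)%N -> f`_n != 0 -> v = 0.
  move=> cf sf fn; apply/rowP => j; rewrite mxE.
  have [l] := ubnP (j : nat); elim: l j => // l IH j; rewrite ltnS => lejl.
  have := congr1 (fun g : {poly F} => g`_(n - j.+1)) cf.
  rewrite coef0 coef_sum (bigD1 j) //= coefZ coef_drop_poly subnK // big1 ?addr0.
    by move/eqP; rewrite mulf_eq0 (negPf fn) orbF => /eqP.
  move=> i ij; rewrite coefZ coef_drop_poly.
  have [ltij|leji] := ltnP i j; first by rewrite IH ?mul0r // (leq_trans ltij).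
  rewrite nth_default ?mulr0 //; apply: leq_trans sf _.
  have ltji : (j < i)%N by rewrite ltn_neqAle eq_sym ij.
  have := ltn_ord j; lia.
case: su => s1 s2 s3; case/eqP: v0.
by case/or3P: un => [/comb0|/comb0|/comb0]; apply.
Qed.

(** * The Sylvester matrix of forms with a common zero *)

Lemma sylvester_row_horner {T : comNzRingType} m1 m2 (P : nat -> T) (t u : T) i : (i < m2)%N ->
  (forall k, (m1 < k)%N -> P k = 0) ->
  \sum_(0 <= j < m1 + m2) (if (i <= j)%N then P (j - i)%N else 0) * (t ^+ j * u ^+ (m1 + m2 - j.+1)) =
  t ^+ i * u ^+ (m2 - i.+1) * \sum_(k < m1.+1) P k * t ^+ k * u ^+ (m1 - k).
Proof.
move=> lti P0; rewrite (big_cat_nat (n := i)) //=; last by lia.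
rewrite big_nat_cond big1 ?add0r; last first.
  by move=> j /andP[/andP[_ ltji] _]; rewrite leqNgt ltji mul0r.
rewrite -{1}[i]add0n big_addn (big_cat_nat (n := m1.+1)) //=; last by lia.
rewrite [X in _ + X]big_nat_cond [X in _ + X]big1 ?addr0; last first.
  by move=> j /andP[/andP[ltj _] _]; rewrite leq_addl addnK P0 ?mul0r.
rewrite big_mkord big_distrr; apply: eq_bigr => k _ /=.
have lek := leq_ord k; rewrite leq_addl addnK.
have -> : (m1 + m2 - (k + i).+1 = m2 - i.+1 + (m1 - k))%N by lia.
by rewrite !exprD; ring.
Qed.

(** A common zero makes the vector of monomials of degree m1 + m2 - 1 in [t], [u] a kernel vector;
    its last entry is a power of [t], hence nonzero. *)
Lemma det_sylvester_common_zero {T : idomainType} m1 m2 (P Q : nat -> T) (t u : T) :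
  (0 < m1 + m2)%N -> t != 0 ->
  (forall k, (m1 < k)%N -> P k = 0) -> (forall k, (m2 < k)%N -> Q k = 0) ->
  \sum_(k < m1.+1) P k * t ^+ k * u ^+ (m1 - k) = 0 ->
  \sum_(k < m2.+1) Q k * t ^+ k * u ^+ (m2 - k) = 0 ->
  \det (sylvester_mx m1 m2 P Q) = 0.
Proof.
move=> n0 t0 P0 Q0 Pz Qz; rewrite -det_tr; apply/eqP/det0P.
exists (\row_j (t ^+ j * u ^+ (m1 + m2 - j.+1))).
  apply/negP => /eqP /rowP v0; have ltn : ((m1 + m2).-1 < m1 + m2)%N by rewrite prednK.
  have /eqP := v0 (Ordinal ltn); rewrite !mxE /= prednK // subnn expr0 mulr1.
  by rewrite expf_eq0 (negPf t0) andbF.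
apply/rowP => i; rewrite !mxE; case: (ltnP i m2) => [lti|lei].
  transitivity (t ^+ i * u ^+ (m2 - i.+1) * \sum_(k < m1.+1) P k * t ^+ k * u ^+ (m1 - k)).
    rewrite -sylvester_row_horner // big_mkord; apply: eq_bigr => j _.
    by rewrite !mxE lti mulrC.
  by rewrite Pz mulr0.
have lti : (i - m2 < m1)%N by have := ltn_ord i; lia.
transitivity (t ^+ (i - m2) * u ^+ (m1 - (i - m2).+1) * \sum_(k < m2.+1) Q k * t ^+ k * u ^+ (m2 - k)).
  rewrite -sylvester_row_horner // [X in _ = \sum_(0 <= _ < X) _]addnC big_mkord; apply: eq_bigr => j _.
  by rewrite !mxE ltnNge lei /= [(m2 + m1)%N]addnC mulrC.
by rewrite Qz mulr0.
Qed.

(** * Syzygies and the mu-basis *)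

Lemma dehomog_dot3 {R : comNzRingType} (u w : {poly {poly R}} * {poly {poly R}} * {poly {poly R}}) :
  dehomog (dot3 u w) = dot3 (map3 dehomog u) (map3 dehomog w).
Proof. by rewrite /dot3 !dehomogD !dehomogM. Qed.

Lemma dehomog_cross3 {R : comNzRingType} (u w : {poly {poly R}} * {poly {poly R}} * {poly {poly R}}) :
  map3 dehomog (cross3 u w) = cross3 (map3 dehomog u) (map3 dehomog w).
Proof.
by congr (_, _, _); rewrite /= dehomogB 2!dehomogM.
Qed.

Lemma homog2_cross3 {R : comNzRingType} m1 m2 (u w : {poly {poly R}} * {poly {poly R}} * {poly {poly R}}) :
  all3 (homog2 m1) u -> all3 (homog2 m2) w -> all3 (homog2 (m1 + m2)) (cross3 u w).
Proof. by case=> u1 u2 u3 [w1 w2 w3]; split; apply: homog2B; apply: homog2M. Qed.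

(** If p × q = 0, each relation q_k p - p_k q = 0 forces p_k = 0 by freeness; then p = 0 is itself a
    nontrivial relation. *)
Lemma cross3_free_neq0 {R : idomainType} (p q : {poly {poly R}} * {poly {poly R}} * {poly {poly R}}) :
  (forall al be, lincomb2 al be p q = (0, 0, 0) -> al = 0 /\ be = 0) -> cross3 p q <> 0.
Proof.
case: p q => [[p1 p2] p3] [[q1 q2] q3]; rewrite /lincomb2 /cross3 /= => free [].
move=> /subr0_eq E1 /subr0_eq E2 /subr0_eq E3.
have comp0 pk qk : (pk == p1) && (qk == q1) || (pk == p2) && (qk == q2) || (pk == p3) && (qk == q3) ->
    pk = 0.
  move=> hk; apply/eqP; rewrite -oppr_eq0; apply/eqP; apply: (free qk (- pk) _).2.
  have E (x y : {poly {poly R}}) : x = y -> x + - y = 0 by move=> ->; rewrite subrr.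
  rewrite !mulNr; case/orP: hk => [/orP [|]|] /andP [/eqP -> /eqP ->];
    by congr (_, _, _); apply: E; rewrite mulrC // ?E1 ?E2 ?E3.
have p10 : p1 = 0 by apply: (comp0 _ q1); rewrite !eqxx.
have p20 : p2 = 0 by apply: (comp0 _ q2); rewrite !eqxx orbT.
have p30 : p3 = 0 by apply: (comp0 _ q3); rewrite !eqxx orbT.
have [|/eqP] := free 1 0; last by rewrite oner_eq0.
by rewrite p10 p20 p30 !mulr0 !mul0r addr0.
Qed.

Lemma all3_dehomog_size {R : comNzRingType} n (u : {poly {poly R}} * {poly {poly R}} * {poly {poly R}}) :
  all3 (homog2 n) u -> all3 (fun f : {poly R} => (size f <= n.+1)%N) (map3 dehomog u).
Proof. by case=> *; split; apply: size_dehomog. Qed.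

(** Since phi is orthogonal to p and q, p × q is parallel to phi; both have degree m1 + m2, so the
    multiplier is constant, and freeness makes it nonzero. *)
Lemma syzygy_basis_cross3 {F : fieldType} m1 m2 (phi p q : {poly {poly F}} * {poly {poly F}} * {poly {poly F}})
    (x : {poly F} * {poly F} * {poly F}) :
  all3 (homog2 m1) p -> all3 (homog2 m2) q ->
  dot3 phi p = 0 -> dot3 phi q = 0 -> dot3 x (map3 dehomog phi) = 1 ->
  [|| (dehomog phi.1.1)`_(m1 + m2) != 0, (dehomog phi.1.2)`_(m1 + m2) != 0
    | (dehomog phi.2)`_(m1 + m2) != 0] ->
  (forall al be, lincomb2 al be p q = (0, 0, 0) -> al = 0 /\ be = 0) ->
  exists2 k : F, k != 0 &
    cross3 (map3 dehomog p) (map3 dehomog q) = scale3 k%:P (map3 dehomog phi).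
Proof.
move=> hp hq php phq xphi top free; have hpq := homog2_cross3 _ _ _ _ hp hq.
have par : cross3 (cross3 (map3 dehomog p) (map3 dehomog q)) (map3 dehomog phi) = 0.
  have E u w : dot3 u w = 0 -> dot3 (map3 (@dehomog F) u) (map3 dehomog w) = 0.
    by rewrite -dehomog_dot3 => ->; rewrite dehomog0.
  have /= [E1 E2 E3] := cross3_orthogonal _ _ _ (E _ _ php) (E _ _ phq).
  rewrite {1}/cross3 -[X in (X, _, _)]opprB -[X in (_, X, _)]opprB -[X in (_, _, X)]opprB.
  by rewrite ![_ * (map3 _ _).1.1]mulrC ![_ * (map3 _ _).1.2]mulrC ![_ * (map3 _ _).2]mulrC
     E1 E2 E3 oppr0.
have [|k sk Ek] := parallel3_size 1 (m1 + m2) x _ _ xphi par top.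
  by rewrite addn1 -dehomog_cross3; apply: all3_dehomog_size.
rewrite Ek [k]size1_polyC //; exists k`_0 => //; apply/eqP => k0.
case: (cross3_free_neq0 _ _ free).
case: hpq => h1 h2 h3; move: Ek; rewrite -dehomog_cross3 [k]size1_polyC // k0 => -[].
rewrite !mulr0 => /(dehomog_eq0 _ _ h1) E1 /(dehomog_eq0 _ _ h2) E2 /(dehomog_eq0 _ _ h3) E3.
by rewrite [LHS]surjective_pairing [X in (X, _)]surjective_pairing E1 E2 E3.
Qed.

(** * Factorization of the Bézout matrix and vanishing of the Sylvester determinant *)

Lemma pair_coef_cross_cross {R : comNzRingType} phi (u p q : {poly R} * {poly R} * {poly R}) i :
  pair_coef phi (scale3 (dot3 u q) p) i - pair_coef phi (scale3 (dot3 u p) q) i =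
  pair_coef phi (cross3 u (cross3 p q)) i.
Proof.
rewrite cross3_cross3; move: (dot3 u q) (dot3 u p) => f g.
rewrite /pair_coef /dot3 /= !coefB !cst2B !mulrBl.
by rewrite !opprD [LHS]addrACA [X in X + _ = _]addrACA.
Qed.

Lemma pair_coef_cross_scale {R : comNzRingType} phi (u v : {poly R} * {poly R} * {poly R}) k i :
  pair_coef phi (cross3 u (scale3 k%:P v)) i = cst2 k * pair_coef phi (cross3 u v) i.
Proof.
have -> : cross3 u (scale3 k%:P v) = map3 (fun f => k *: f) (cross3 u v).
  by rewrite /cross3 /scale3 /map3 /= -!mul_polyC; congr (_, _, _); ring.
rewrite /pair_coef /dot3 /= !coefZ !cst2M !mulrDr !mulrA.
by [].
Qed.

Lemma bezout_FG_factor {F : closedFieldType} m1 m2 (a b c : {poly {poly F}})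
    (p q : {poly {poly F}} * {poly {poly F}} * {poly {poly F}}) :
  all3 (homog2 (m1 + m2)) (a, b, c) -> coprime3 a b c ->
  all3 (homog2 m1) p -> all3 (homog2 m2) q ->
  syzygy a b c p -> syzygy a b c q ->
  (forall al be, lincomb2 al be p q = (0, 0, 0) -> al = 0 /\ be = 0) ->
  exists2 N : 'M[{poly {poly F}}]_(m1 + m2), N \in unitmx &
    bezout_mx (m1 + m2) (FG_coef (m1 + m2) a c) (FG_coef (m1 + m2) b c) =
    c *: ((sylvester_mx m1 m2 (phi_coef m1 a b c p) (phi_coef m2 a b c q))^T *m N).
Proof.
move=> [ha hb hc] co hp hq sp sq free; pose phi := (a, b, c).
have [x [y [z xyz]]] := coprime3_Bezout _ _ _ _ ha hb hc co.
have top := coprime3_top _ _ _ _ ha hb hc co.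
have syzE h : syzygy a b c h -> dot3 phi h = 0.
  by rewrite /syzygy /dot3 /= ![_ * a]mulrC ![_ * b]mulrC ![_ * c]mulrC.
have phip := syzE _ sp; have phiq := syzE _ sq.
have X1 : dot3 (x, y, z) (map3 dehomog phi) = 1 by [].
have [k k0 pq] := syzygy_basis_cross3 _ _ phi _ _ _ hp hq phip phiq X1 top free.
set u := map3 dehomog phi in X1 pq; set p' := map3 dehomog p in pq.
set q' := map3 dehomog q in pq.
have up : dot3 u p' = 0 by rewrite -dehomog_dot3 phip dehomog0.
have uq : dot3 u q' = 0 by rewrite -dehomog_dot3 phiq dehomog0.
have su : all3 (fun f : {poly F} => (size f <= (m1 + m2).+1)%N) u by exact: all3_dehomog_size.
have sizep := all3_dehomog_size _ _ hp; have sizeq := all3_dehomog_size _ _ hq.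
have UN := comp_mx_unit m1 m2 k (x, y, z) u p' q' k0 X1 pq up uq su top sizep sizeq.
set N0 := comp_mx _ _ _ _ in UN.
(* The factor [k^-1] compensates p' × q' = k u. *)
exists (map_mx (@cst2 F) (k^-1 *: N0)).
  by rewrite map_unitmx unitmxZ // unitfE invr_eq0.
apply/matrixP => i j; rewrite bezout_FGE // map_mxZ -scalemxAr 2!mxE; congr (_ * _).
have Ep k' := phi_coefE m1 a b c p k' hp; have Eq k' := phi_coefE m2 a b c q k' hq.
have -> : sylvester_mx m1 m2 (phi_coef m1 a b c p) (phi_coef m2 a b c q) =
  sylvester_mx m1 m2 (pair_coef phi p') (pair_coef phi q').
  apply/matrixP => i' j'; rewrite [LHS]mxE [RHS]mxE.
  by rewrite Ep Eq.
rewrite sylvester_comp_mxE; [|exact: size_dot3_drop..].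
rewrite pair_coef_cross_cross pq pair_coef_cross_scale mulrA -cst2M.
by rewrite mulVf // mul1r.
Qed.

(** At (s : v) = (t : u) the forms p_phi and q_phi become the syzygy relations, so they have a
    common zero. *)
Lemma det_sylvester_syzygies {R : idomainType} m1 m2 (a b c : {poly {poly R}})
    (p q : {poly {poly R}} * {poly {poly R}} * {poly {poly R}}) :
  (0 < m1 + m2)%N -> all3 (homog2 m1) p -> all3 (homog2 m2) q ->
  syzygy a b c p -> syzygy a b c q ->
  \det (sylvester_mx m1 m2 (phi_coef m1 a b c p) (phi_coef m2 a b c q)) = 0.
Proof.
move=> n0 hp hq sp sq.
have coef_gt m h k : (m < k)%N -> phi_coef m a b c h k = 0.
  by move=> ltmk; rewrite /phi_coef !coef2_gt // cst2_0 !mul0r !addr0.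
have zero m h : all3 (homog2 m) h -> syzygy a b c h ->
    \sum_(k < m.+1) phi_coef m a b c h k * var1 R ^+ k * var2 R ^+ (m - k) = 0.
  case=> h1 h2 h3 hs; pose f x := \sum_(k < m.+1) cst2 (coef2 m x k) * var1 R ^+ k * var2 R ^+ (m - k).
  transitivity (f h.1.1 * a + f h.1.2 * b + f h.2 * c); last first.
    by rewrite -[RHS]hs /f -(homog2_sum m h.1.1 h1) -(homog2_sum m h.1.2 h2) -(homog2_sum m h.2 h3).
  rewrite /f !big_distrl -!big_split; apply: eq_bigr => k _ /=.
  rewrite /phi_coef; move: (cst2 _) (cst2 _) (cst2 _) (var1 R ^+ k) (var2 R ^+ _) => x1 x2 x3 x4 x5.
  ring.
apply: (det_sylvester_common_zero m1 m2 _ _ (var1 R) (var2 R)) => //.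
- by rewrite polyX_eq0.
- exact: coef_gt.
- exact: coef_gt.
- exact: zero.
- exact: zero.
Qed.

(** * Gcds of the minors of the Bézout matrix *)

Theorem theorem6p2 (R : numClosedFieldType) (n : nat) (a b c : {poly {poly R}})
  (mu : nat) (p q : {poly {poly R}} * {poly {poly R}} * {poly {poly R}})
  (d : nat -> {poly {poly R}}) :
  (3 <= n)%N ->
  homog2 n a -> homog2 n b -> homog2 n c ->
  coprime3 a b c ->
  birational_onto_image a b c ->
  mu_basis n a b c mu p q ->
  (forall i, (1 <= i <= n)%N -> exists e, homog2 e (d i)) ->
  (forall i, (1 <= i <= n)%N ->
     is_gcd_of
       (minors_set (n.+1 - i)
          (sylvester_mx mu (n - mu) (phi_coef mu a b c p) (phi_coef (n - mu) a b c q)))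
       (\prod_(i <= j < n.+1) d j ^+ (j - i).+1)) ->
  let B := bezout_mx n (FG_coef n a c) (FG_coef n b c) in
  is_gcd_of (minors_set n B) 0 /\
  (forall i, (1 <= i <= n - 1)%N ->
     is_gcd_of (minors_set (n - i) B)
       (c ^+ (n - i) * \prod_(i.+1 <= j < n.+1) d j ^+ (j - i))).
Proof.
move=> n3 ha hb hc co _ [lemu [hp [hq [[sp sq] [_ free]]]]] _ gcdS /=.
have En : n = (mu + (n - mu))%N by lia.
move: (n - mu)%N En hq gcdS lemu => m En hq gcdS _; subst n.
have hp3 : all3 (homog2 mu) p by case: hp => ? [].
have hq3 : all3 (homog2 m) q by case: hq => ? [].
have habc : all3 (homog2 (mu + m)) (a, b, c) by [].
have [N UN ->] := bezout_FG_factor mu m a b c p q habc co hp3 hq3 sp sq free.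
split=> [|i /andP [i0 ltin]].
  apply: is_gcd_of_minors_full0; rewrite detZ det_mulmx det_tr.
  by rewrite det_sylvester_syzygies ?mul0r ?mulr0 //; lia.
apply: is_gcd_of_minors_scale; first exact/gcd_multiplierX/gcd_multiplier_homog2/hc.
apply: is_gcd_of_minors_tr_mul => //.
(* Minors of order n - i are those of the singular factor hypothesis at index i + 1, where the
   exponent (j - (i + 1)) + 1 equals j - i. *)
have := gcdS i.+1; rewrite subSS => /(_ _).
have -> : \prod_(i.+1 <= j < (mu + m).+1) d j ^+ (j - i.+1).+1 =
          \prod_(i.+1 <= j < (mu + m).+1) d j ^+ (j - i).
  by apply: eq_big_nat => j /andP [ltij _]; rewrite subnSK.
by apply; lia.
Qed.
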